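(* There is an absolute constant $C>0$ such that for every set $S$ of $n\ge 3$ points in strictly convex position in the plane, the number of triangles with vertices in $S$ whose area equals the minimum area among all triangles with vertices in $S$ is at most $C n$. Moreover, this is asymptotically tight: for every $n\ge 3$ there is a set of $n$ points in strictly convex position with at least $n$ triangles of minimum area.
   Context: A point set is in strictly convex position if each point is a vertex of the convex hull and no three points are collinear. A triangle spanned by $S$ is an unordered triple of points of $S$.
   Formalization: The tightness part is stated for every n ≥ 4 instead of n ≥ 3, because three points span only one triangle, so a set of n = 3 points cannot have at least 3 triangles of minimum area. *)

(* Defs.v *)
From HB Require Import structures.
From mathcomp Require Import all_boot all_order all_algebra.
From mathcomp Require Import finmap.
From mathcomp Require Import mathcomp_extra boolp classical_sets reals.
From mathcomp Require Import interval_inference convex.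
From mathcomp Require Import ring.

Set Implicit Arguments.
Unset Strict Implicit.
Unset Printing Implicit Defensive.

Import Order.TTheory GRing.Theory Num.Theory.

Local Open Scope classical_set_scope.
Local Open Scope fset_scope.
Local Open Scope ring_scope.
Local Open Scope convex_scope.

Definition convex_hull (R : numDomainType) (M : lmodType R) (A : set M) :
    set M :=
  smallest (@convex_set R M) A.

(* The vertices of the convex hull of a finite set are the extreme points of
   that hull. *)
Definition extreme_point (R : numDomainType) (M : lmodType R) (A : set M)
    (p : M) : Prop :=
  A p /\ forall (x y : convex_lmodType M) (t : {i01 R}),
    A x -> A y -> 0 < t%:num < 1 -> p = x <| t |> y -> x = p /\ y = p.

Definition collinear (R : numDomainType) (M : lmodType R) (p q r : M) : Prop :=
  exists (a u : M) (s t v : R),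
    [/\ p = a + s *: u, q = a + t *: u & r = a + v *: u].

Definition strictly_convex_position (R : realType) (S : {fset 'rV[R]_2}) :
    Prop :=
  (forall p, p \in S -> extreme_point (convex_hull [set` S]) p) /\
  (forall p q r, p \in S -> q \in S -> r \in S ->
     p != q -> q != r -> p != r -> ~ collinear p q r).

Definition area3 (R : realType) (p q r : 'rV[R]_2) : R :=
  `| (q 0 0 - p 0 0) * (r 0 1 - p 0 1) -
     (q 0 1 - p 0 1) * (r 0 0 - p 0 0) | / 2.

(* Meant for triples only: the points of T are taken in an arbitrary order,
   which is harmless by symmetry of the area; see triangle_areaE. *)
Definition triangle_area (R : realType) (T : {fset 'rV[R]_2}) : R :=
  let s := enum_fset T in area3 s`_0 s`_1 s`_2.

Definition triangles (R : realType) (S : {fset 'rV[R]_2}) :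
    {fset {fset 'rV[R]_2}} :=
  [fset T in fpowerset S | #|` T| == 3].

Definition min_area_triangles (R : realType) (S : {fset 'rV[R]_2}) :
    {fset {fset 'rV[R]_2}} :=
  [fset T in triangles S |
    all (fun T' => triangle_area T <= triangle_area T')
        (enum_fset (triangles S))].

Lemma area3C (R : realType) (p q r : 'rV[R]_2) : area3 p q r = area3 p r q.
Proof.
by rewrite /area3 -normrN opprB ![(r _ _ - _) * (q _ _ - _)]mulrC.
Qed.

Lemma area3_rot (R : realType) (p q r : 'rV[R]_2) : area3 p q r = area3 q r p.
Proof.
rewrite /area3; congr (`|_| / 2).
by ring.
Qed.

Lemma triangle_areaE (R : realType) (p q r : 'rV[R]_2) :
  p != q -> q != r -> p != r -> triangle_area [fset p; q; r] = area3 p q r.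
Proof.
move=> pq qr pr; rewrite /triangle_area.
have : perm_eq (enum_fset [fset p; q; r]) [:: p; q; r].
  apply: uniq_perm; first exact: fset_uniq.
    by rewrite /= !inE negb_or pq pr qr.
  by move=> x; rewrite !inE orbA.
case: (enum_fset _) => [/perm_size//|a [/perm_size//|b [/perm_size//|c]]].
case=> [|? ? /perm_size//] pabc /=.
have ua : uniq [:: a; b; c].
  by rewrite (perm_uniq pabc) /= !inE negb_or pq pr qr.
have M x : x \in [:: a; b; c] -> [|| x == p, x == q | x == r].
  by rewrite (perm_mem pabc) !inE.
move: ua (M a) (M b) (M c); rewrite /= !inE !eqxx !orbT negb_or andbT.
move=> /andP[/andP[ab ac] bc] /(_ isT) + /(_ isT) + /(_ isT).
move=> /or3P[]/eqP ? /or3P[]/eqP ? /or3P[]/eqP ?; subst; rewrite ?eqxx// in ab ac bc *.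
all: do [exact: area3C | exact: area3_rot | by rewrite -area3_rot
        | by rewrite area3C area3_rot | by rewrite area3_rot area3C].
Qed.

Lemma min_area_trianglesP (R : realType) (S T : {fset 'rV[R]_2}) :
  reflect (T \in triangles S /\
           forall T', T' \in triangles S -> triangle_area T <= triangle_area T')
          (T \in min_area_triangles S).
Proof.
rewrite [X in reflect _ X]in_fset; apply: (iffP andP) => [[TS /allP]|[TS mT]]; split=> //.
exact/allP.
Qed.

(* A set of three points spans a single triangle, so "at least n triangles of
   minimum area" fails for n = 3. *)
Lemma card_min_area_triangles3 (R : realType) (S : {fset 'rV[R]_2}) :
  #|` S| = 3 -> #|` min_area_triangles S| = 1.
Proof.
move=> S3.
have tE : triangles S = [fset S].
  apply/fsetP => T; rewrite !inE fpowersetE; apply/andP/eqP => [[TS /eqP T3]|->].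
    by apply/eqP; rewrite eqEfcard TS S3 T3.
  by rewrite fsubset_refl S3.
suff -> : min_area_triangles S = [fset S] by rewrite cardfs1.
apply/fsetP => T; apply/min_area_trianglesP/idP => [[]|]; rewrite tE //.
by move=> /fset1P ->; split=> [|T' /fset1P -> //]; rewrite fset11.
Qed.

(* Main.v *)
(* Upper bound.  Let abc be a triangle of minimum area m, and let d be a point
   of S beyond the side bc.  All the triangles spanned by a, b, c, d have area
   at least m, so d is at least as far from the line ab as c, and at least as
   far from ca as b.  If e lies beyond ca, then likewise e is at least as far
   from ab as c, so c lies in the triangle ade, which contradicts convex
   position.  Hence points of S lie beyond at most one side, the other two
   sides are hull edges, and abc consists of three consecutive hull vertices:
   it is determined by its middle vertex, and C = 1 works.

   Lower bound.  In the regular n-gon inscribed in the unit circle, with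
   h = pi / n, the triangles have area 2 sin x sin y sin (x + y) with
   h <= x, y and x + y <= pi - h.  From
   sin x sin y - sin h sin (x + y - h) = sin (x - h) sin (y - h) >= 0,
   applied twice, the minimum is 2 sin^2 h sin 2h, attained by the n triangles
   of consecutive vertices, which are pairwise distinct for n >= 4. *)
Require Import Defs.
From HB Require Import structures.
From mathcomp Require Import all_boot all_order all_algebra.
From mathcomp Require Import finmap.
From mathcomp Require Import boolp classical_sets reals.
From mathcomp Require Import interval_inference convex.
From mathcomp Require Import trigo.
From mathcomp Require Import ring lra zify.

Set Implicit Arguments.
Unset Strict Implicit.
Unset Printing Implicit Defensive.

Import Order.TTheory GRing.Theory Num.Theory.

Local Open Scope fset_scope.
Local Open Scope ring_scope.

(** * Three-element finite sets *)

Lemma cardfs3 (K : choiceType) (p q r : K) :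
  p != q -> q != r -> p != r -> #|` [fset p; q; r]| = 3.
Proof.
move=> pq qr pr.
by rewrite fsetUC cardfsU1 cardfs2 !inE negb_or ![r == _]eq_sym pr qr pq.
Qed.

Lemma fset3P (K : choiceType) (T : {fset K}) : #|` T| = 3 ->
  exists a b c, [/\ T = [fset a; b; c], a != b, b != c & a != c].
Proof.
move=> T3; have := fset_uniq T; have TE x : (x \in T) = (x \in enum_fset T) by [].
move: T3.
case: (enum_fset T) TE => [|a [|b [|c [|]]]]//= TE _.
rewrite !inE negb_or andbT => /andP[/andP[ab ac] bc].
by exists a, b, c; split=> //; apply/fsetP => x; rewrite TE !inE orbA.
Qed.

(** * Orientation determinant and collinearity *)

Section MinimumAreaTriangles.
Variable R : realType.
Implicit Types (S T : {fset 'rV[R]_2}) (a b c d e p q r x y z : 'rV[R]_2).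

(** Twice the signed area: positive for a counterclockwise triple, so its sign tells on which side
    of the line [p q] the point [r] lies. *)
Definition det3 p q r : R :=
  (q 0 0 - p 0 0) * (r 0 1 - p 0 1) - (q 0 1 - p 0 1) * (r 0 0 - p 0 0).

Lemma area3_det3 p q r : area3 p q r = `|det3 p q r| / 2.
Proof. by []. Qed.

Lemma det3_rot p q r : det3 p q r = det3 q r p.
Proof. by rewrite /det3; ring. Qed.

Lemma det3C p q r : det3 p r q = - det3 p q r.
Proof. by rewrite /det3; ring. Qed.

Lemma det3_diag p q : det3 p q p = 0.
Proof. by rewrite /det3; ring. Qed.

Lemma det3_diagr p q : det3 p q q = 0.
Proof. by rewrite /det3; ring. Qed.

(** The summands are the unnormalised barycentric coordinates of [x] with respect to [a], [b],
    [c]. *)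
Lemma det3_sum a b c x : det3 b c x + det3 c a x + det3 a b x = det3 a b c.
Proof. by rewrite /det3; ring. Qed.

Lemma rV2P x y : x 0 0 = y 0 0 -> x 0 1 = y 0 1 -> x = y.
Proof.
move=> e0 e1; apply/rowP => -[[|[|//]] i].
  by rewrite (_ : Ordinal i = 0) //; apply: val_inj.
by rewrite (_ : Ordinal i = 1) //; apply: val_inj.
Qed.

Lemma det3_eq0_collinear p q r : p != q -> det3 p q r = 0 -> collinear p q r.
Proof.
move=> pq d0; exists p, (q - p), 0, 1.
(* The parameter of [r] on the line is read off a coordinate in which [p] and [q] differ. *)
have [e0|n0] := eqVneq (q 0 0) (p 0 0).
  have n1 : q 0 1 - p 0 1 != 0.
    by rewrite subr_eq0; apply: contra pq => /eqP e1; apply/eqP/rV2P.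
  exists ((r 0 1 - p 0 1) / (q 0 1 - p 0 1)); split.
  - by rewrite scale0r addr0.
  - by rewrite scale1r addrC subrK.
  - apply: rV2P; rewrite !mxE; last by field.
    move: d0; rewrite /det3 e0 subrr mul0r sub0r mulr0 addr0 => /eqP.
    by rewrite oppr_eq0 mulf_eq0 (negbTE n1)/= subr_eq0 => /eqP.
have n1 : q 0 0 - p 0 0 != 0 by rewrite subr_eq0.
exists ((r 0 0 - p 0 0) / (q 0 0 - p 0 0)); split.
- by rewrite scale0r addr0.
- by rewrite scale1r addrC subrK.
- apply: rV2P; rewrite !mxE; first by field.
  apply: (mulfI n1); move: d0; rewrite /det3 => d0.
  transitivity ((q 0 0 - p 0 0) * p 0 1 + (r 0 0 - p 0 0) * (q 0 1 - p 0 1)).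
    lra.
  by field.
Qed.

Lemma collinear_det3 p q r : collinear p q r -> det3 p q r = 0.
Proof.
by move=> [a [u [s [t [v [-> -> ->]]]]]]; rewrite /det3 !mxE; ring.
Qed.

(** * Convex position and points in triangles *)

Lemma convex_hull_convex (A : set 'rV[R]_2) x y (t : R) :
  0 <= t -> t <= 1 -> convex_hull A x -> convex_hull A y ->
  convex_hull A (t *: x + (1 - t) *: y).
Proof.
move=> t0 t1 Ax Ay B [cB AB].
have xB : x \in B by rewrite inE; apply: Ax.
have yB : y \in B by rewrite inE; apply: Ay.
have /= := cB x y (Itv01 t0 t1) xB yB.
by rewrite inE.
Qed.

(** The determinants are barycentric weights of [p] on [x], [y], [z], so [p] is a convex
    combination, with parameter strictly between 0 and 1, of [x] and a point of the side [y z].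
    Extremality then gives [x = p], against the positive weight on [y]. *)
Lemma convex_position_not_in_triangle S p x y z :
  strictly_convex_position S -> p \in S -> x \in S -> y \in S -> z \in S ->
  0 < det3 y z p -> 0 < det3 z x p -> 0 <= det3 x y p -> False.
Proof.
move=> [ext _] pS xS yS zS.
have : (det3 y z p + det3 z x p + det3 x y p) *: p =
       det3 y z p *: x + det3 z x p *: y + det3 x y p *: z.
  by apply: rV2P; rewrite !mxE /det3; ring.
have xp0 : x = p -> det3 z x p = 0 by move=> ->; rewrite det3_diagr.
move: xp0; set a := det3 y z p; set b := det3 z x p; set c := det3 x y p.
clearbody a b c => xp0 bary a0 b0 c0.
have bc0 : 0 < b + c by lra.
have abc0 : 0 < a + b + c by lra.
have bcN0 : b + c != 0 by rewrite gt_eqF.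
have abcN0 : a + b + c != 0 by rewrite gt_eqF.
have hull u : u \in S -> convex_hull [set` S] u by move=> uS B [_]; apply.
(* The line from [x] through [p] meets the side [y z] at [t *: y + (1 - t) *: z]; [s] is the
   normalised weight of [x]. *)
pose t := b / (b + c); pose s := a / (a + b + c).
have hq : convex_hull [set` S] (t *: y + (1 - t) *: z).
  apply: convex_hull_convex; try exact: hull.
    by rewrite divr_ge0// ltW.
  by rewrite ler_pdivrMr// mul1r lerDl.
have s0 : 0 <= s by rewrite divr_ge0// ltW.
have s1 : s <= 1 by rewrite ler_pdivrMr// mul1r; lra.
have pE : p = s *: x + (1 - s) *: (t *: y + (1 - t) *: z).
  apply: (scalerI abcN0); rewrite bary.
  by apply: rV2P; rewrite !mxE /s /t; field; rewrite bcN0 abcN0.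
have [_ /(_ _ _ (Itv01 s0 s1) (hull _ xS) hq)] := ext p pS.
case=> //=.
  by rewrite divr_gt0//= ltr_pdivrMr// mul1r; lra.
by move=> /xp0 E; rewrite E ltxx in b0.
Qed.

(** * Upper bound: minimum-area triangles are ears *)

Definition hull_edge S a b :=
  forall x, x \in S -> x != a -> x != b -> 0 < det3 a b x.

Definition area_bound S (m : R) :=
  forall p q r, p \in S -> q \in S -> r \in S ->
    p != q -> q != r -> p != r -> m <= `|det3 p q r|.

(** The area bound gives the sizes and convex position the signs: a negative [det3 c a d] would put
    [c] in the triangle [a b d], and a negative [det3 a b d] would put [b] in [d c a]. *)
Lemma beyond_edge S (m : R) a b c d :
  strictly_convex_position S -> area_bound S m -> 0 < m ->
  a \in S -> b \in S -> c \in S -> d \in S ->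
  det3 a b c = m -> det3 b c d < 0 ->
  m <= det3 c a d /\ m <= det3 a b d.
Proof.
move=> scp bnd m0 aS bS cS dS abc bcd.
have abc0 : 0 < det3 a b c by rewrite abc.
have ab : a != b by apply: contraTneq abc0 => ->; rewrite det3_rot det3_diag ltxx.
have bc : b != c by apply: contraTneq abc0 => ->; rewrite det3_diagr ltxx.
have ac : a != c by apply: contraTneq abc0 => ->; rewrite det3_diag ltxx.
have bd : b != d by apply: contraTneq bcd => <-; rewrite det3_diag ltxx.
have cd : c != d by apply: contraTneq bcd => <-; rewrite det3_diagr ltxx.
have ad : a != d.
  by apply: contraTneq bcd => <-; rewrite -det3_rot abc -leNgt ltW.
have ca : c != a by rewrite eq_sym.
have bw := bnd _ _ _ aS bS dS ab bd ad.
have bv := bnd _ _ _ cS aS dS ca ad cd.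
have dbc : 0 < det3 b d c by rewrite det3C oppr_gt0.
split.
  have [v0|v0] := leP 0 (det3 c a d); first by rewrite ger0_norm in bv.
  case: (convex_position_not_in_triangle scp cS aS bS dS) => //.
    by rewrite -det3_rot det3C oppr_gt0.
  exact: ltW.
have [v0|v0] := leP 0 (det3 a b d); first by rewrite ger0_norm in bw.
case: (convex_position_not_in_triangle scp bS dS cS aS) => //.
- by rewrite det3_rot.
- by rewrite det3C oppr_gt0.
- by rewrite -det3_rot ltW.
Qed.

Lemma beyond_two_edges S (m : R) a b c d e :
  strictly_convex_position S -> area_bound S m -> 0 < m ->
  a \in S -> b \in S -> c \in S -> d \in S -> e \in S ->
  det3 a b c = m -> det3 b c d < 0 -> det3 c a e < 0 -> False.
Proof.
move=> scp bnd m0 aS bS cS dS eS abc ud ve.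
have [vd wd] := beyond_edge scp bnd m0 aS bS cS dS abc ud.
have bca : det3 b c a = m by rewrite -det3_rot.
have [we ue] := beyond_edge scp bnd m0 bS cS aS eS bca ve.
have sd := det3_sum a b c d.
have se := det3_sum a b c e.
(* Grassmann-Plücker relation for the vectors from [c] to [a], [b], [d], [e]. *)
have dec : det3 a b c * det3 d e c =
    det3 b c d * det3 c a e - det3 c a d * det3 b c e.
  by rewrite /det3; ring.
case: (convex_position_not_in_triangle scp cS dS eS aS).
- by rewrite -det3_rot det3C oppr_gt0.
- by rewrite -det3_rot; apply: lt_le_trans vd.
(* As [det3 a b d] and [det3 a b e] are at least [m], [sd] and [se] give
   [det3 c a d <= - det3 b c d] and [det3 b c e <= - det3 c a e]; multiplying them gives the
   claim. *)
- rewrite -(pmulr_rge0 _ m0) -abc dec subr_ge0 -[leRHS]mulrNN.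
  by apply: ler_pM; lra.
Qed.

Lemma hull_edgeP S a b : strictly_convex_position S -> a \in S -> b \in S ->
  a != b -> ~ (exists2 x, x \in S & det3 a b x < 0) -> hull_edge S a b.
Proof.
move=> [_ ncol] aS bS ab nx x xS xa xb.
rewrite ltNge le_eqVlt; apply/negP => /orP[/eqP E|lt0]; last by apply: nx; exists x.
by apply: (ncol a b x) => //; rewrite 1?eq_sym//; apply: det3_eq0_collinear.
Qed.

(** The triangle formed by a hull vertex [b] and its hull neighbours, [a] before and [c] after it
    counterclockwise. *)
Definition ear S b T := exists a c,
  [/\ a \in S `\ b, c \in S `\ b, T = [fset a; b; c],
      hull_edge S a b & hull_edge S b c].

(** Two distinct predecessors [a], [a'] of [b] would make both [det3 a b a'] and [det3 a' b a]
    positive, yet these are opposite; likewise for successors. *)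
Lemma ear_inj S b T T' : ear S b T -> ear S b T' -> T = T'.
Proof.
move=> [a [c [/fsetD1P[ab aS] /fsetD1P[cb cS] -> eab ebc]]].
move=> [a' [c' [/fsetD1P[ab' aS'] /fsetD1P[cb' cS'] -> eab' ebc']]].
have -> : a = a'.
  apply/eqP; apply: contraT => aa'; have a'a : a' != a by rewrite eq_sym.
  suff h : det3 a b a' < 0 by have := lt_trans (eab a' aS' a'a ab') h; rewrite ltxx.
  by rewrite det3_rot det3C oppr_lt0 -det3_rot eab'.
have -> // : c = c'.
apply/eqP; apply: contraT => cc'; have c'c : c' != c by rewrite eq_sym.
suff h : det3 b c c' < 0 by have := lt_trans (ebc c' cS' cb' c'c) h; rewrite ltxx.
by rewrite det3C oppr_lt0 ebc'.
Qed.

Lemma min_triangle_is_ear S (m : R) a b c :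
  strictly_convex_position S -> area_bound S m -> 0 < m ->
  a \in S -> b \in S -> c \in S -> det3 a b c = m ->
  [\/ ear S a [fset a; b; c], ear S b [fset a; b; c] | ear S c [fset a; b; c]].
Proof.
move=> scp bnd m0 aS bS cS abc.
have abc0 : 0 < det3 a b c by rewrite abc.
have ab : a != b by apply: contraTneq abc0 => ->; rewrite det3_rot det3_diag ltxx.
have bc : b != c by apply: contraTneq abc0 => ->; rewrite det3_diagr ltxx.
have ca : c != a by apply: contraTneq abc0 => ->; rewrite det3_diag ltxx.
have [ba cb ac] : [/\ b != a, c != b & a != c] by split; rewrite eq_sym.
have bca : det3 b c a = m by rewrite -det3_rot.
have cab : det3 c a b = m by rewrite det3_rot.
have edge p q : p \in S -> q \in S -> p != q ->
    hull_edge S p q \/ exists2 x, x \in S & det3 p q x < 0.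
  move=> pS qS pq; have [?|?] := pselect (exists2 x, x \in S & det3 p q x < 0).
    by right.
  by left; apply: hull_edgeP.
have [eab|[x xS abx]] := edge a b aS bS ab.
  have [ebc|[y yS bcy]] := edge b c bS cS bc.
    by apply: Or32; exists a, c; split=> //; apply/fsetD1P.
  have [eca|[z zS caz]] := edge c a cS aS ca.
    apply: Or31; exists c, b; split=> //; try exact/fsetD1P.
    by apply/fsetP => u; rewrite !inE; case: (u == a); case: (u == b); case: (u == c).
  by case: (beyond_two_edges scp bnd m0 aS bS cS yS zS abc bcy caz).
have [ebc|[y yS bcy]] := edge b c bS cS bc.
  have [eca|[z zS caz]] := edge c a cS aS ca.
    apply: Or33; exists b, a; split=> //; try exact/fsetD1P.
    by apply/fsetP => u; rewrite !inE; case: (u == a); case: (u == b); case: (u == c).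
  by case: (beyond_two_edges scp bnd m0 bS cS aS zS xS bca caz abx).
by case: (beyond_two_edges scp bnd m0 cS aS bS xS yS cab abx bcy).
Qed.

Lemma min_area_triangle_ear S T : strictly_convex_position S ->
  T \in min_area_triangles S -> exists2 b, b \in S & ear S b T.
Proof.
move=> scp /min_area_trianglesP[].
rewrite !inE fpowersetE => /andP[TS /eqP/fset3P[a [b [c [TE ab bc ac]]]]] minT.
(* Swapping [b] and [c] reverses the orientation; a zero determinant contradicts the absence of
   collinear triples. *)
wlog abc : b c TE ab bc ac / 0 < det3 a b c.
  move=> W; have [abc|abc|abc0] := ltgtP 0 (det3 a b c); first exact: (W b c).
    apply: (W c b) => //; last by rewrite det3C oppr_gt0.
      by rewrite TE; apply/fsetP => u; rewrite !inE orbAC.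
    by rewrite eq_sym.
  case: scp => _ /(_ a b c) []//; try by apply: (fsubsetP TS); rewrite TE !inE eqxx ?orbT.
  exact: det3_eq0_collinear.
have [aS bS cS] : [/\ a \in S, b \in S & c \in S].
  by split; apply: (fsubsetP TS); rewrite TE !inE eqxx ?orbT.
have bnd : area_bound S (det3 a b c).
  move=> p q r pS qS rS pq qr pr.
  have := minT [fset p; q; r]; rewrite TE !triangle_areaE// !area3_det3.
  rewrite ler_pM2r// (gtr0_norm abc); apply.
  rewrite !inE fpowersetE; apply/andP; split.
    by apply/fsubsetP => u; rewrite !inE => /orP[/orP[]|] /eqP->.
  exact/eqP/cardfs3.
rewrite TE; case: (min_triangle_is_ear scp bnd abc aS bS cS erefl);
  by [exists a | exists b | exists c].
Qed.

Lemma card_min_area_triangles_le S : strictly_convex_position S ->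
  (#|` min_area_triangles S| <= #|` S|)%N.
Proof.
move=> scp.
(* [f] sends a minimum-area triangle to the vertex where it is an ear, with dummy value [0]
   elsewhere; [ear_inj] makes it injective on these triangles. *)
have /choice[f fP] T : exists b, T \in min_area_triangles S -> b \in S /\ ear S b T.
  have [/(min_area_triangle_ear scp)[b bS eb]|_] := boolP (T \in min_area_triangles S).
    by exists b.
  by exists 0.
have <- : #|` [fset f T | T in min_area_triangles S]| = #|` min_area_triangles S|.
  apply: card_in_imfset => T T' TM T'M fTT'.
  have [bS eT] := fP T TM; have [_ eT'] := fP T' T'M; rewrite -fTT' in eT'.
  exact: ear_inj eT eT'.
apply/fsubset_leq_card/fsubsetP => _ /imfsetP[T /= TM ->].
by have [] := fP T TM.
Qed.

End MinimumAreaTriangles.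

(** * Points on the unit circle: extremality and determinants *)

Section RegularPolygon.
Variable R : realType.
Implicit Types (t x y z h : R) (p q r : 'rV[R]_2).

Definition disk : set 'rV[R]_2 := [set p | p 0 0 ^+ 2 + p 0 1 ^+ 2 <= 1]%classic.

(** The subtracted term is the convexity defect of the squared norm: its sign makes the disk convex,
    and its strictness makes unit vectors extreme. *)
Lemma sqnorm_conv (t a b c d : R) :
  (t * a + (1 - t) * b) ^+ 2 + (t * c + (1 - t) * d) ^+ 2 =
  t * (a ^+ 2 + c ^+ 2) + (1 - t) * (b ^+ 2 + d ^+ 2) -
  t * (1 - t) * ((a - b) ^+ 2 + (c - d) ^+ 2).
Proof. by ring. Qed.

Lemma disk_convex : convex_set disk.
Proof.
move=> x y t; rewrite !inE /disk /= !mxE => xD yD.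
have t0 : 0 <= t%:num by [].
have t1 : t%:num <= 1 by [].
rewrite /unstable.onem sqnorm_conv.
have : 0 <= t%:num * (1 - t%:num) * ((x 0 0 - y 0 0) ^+ 2 + (x 0 1 - y 0 1) ^+ 2).
  by rewrite !mulr_ge0 ?subr_ge0// addr_ge0// sqr_ge0.
nra.
Qed.

(** When a combination of two points of the disk has norm 1, the defect in [sqnorm_conv] must
    vanish, so the two points coincide. *)
Lemma unit_circle_extreme (A : set 'rV[R]_2) p : (A `<=` disk)%classic -> A p ->
  p 0 0 ^+ 2 + p 0 1 ^+ 2 = 1 -> extreme_point (convex_hull A) p.
Proof.
move=> AD Ap p1; split; first by move=> B [_]; apply.
have hD : (convex_hull A `<=` disk)%classic.
  by apply: smallest_sub => //; exact: disk_convex.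
move=> x y t /hD xD /hD yD /andP[t0 t1] pE.
suff xy : x = y by rewrite pE xy convmm.
move: p1; rewrite pE !mxE /unstable.onem sqnorm_conv => E.
rewrite /disk /= in xD yD.
have tt : 0 < t%:num * (1 - t%:num) by rewrite mulr_gt0// subr_gt0.
have : t%:num * (1 - t%:num) * ((x 0 0 - y 0 0) ^+ 2 + (x 0 1 - y 0 1) ^+ 2) <= 0.
  nra.
rewrite pmulr_rle0// => le0.
have := paddr_eq0 (sqr_ge0 (x 0 0 - y 0 0)) (sqr_ge0 (x 0 1 - y 0 1)).
rewrite !sqrf_eq0 !subr_eq0 eq_le le0 addr_ge0 ?sqr_ge0//= => /esym/andP[/eqP + /eqP].
exact: rV2P.
Qed.

(* The point of polar angle 2x: doubling keeps half-angles out of det3_circle. *)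
Definition circle x : 'rV[R]_2 :=
  \row_j (if j == 0 then cos (x *+ 2) else sin (x *+ 2)).

Lemma circle_norm x : circle x 0 0 ^+ 2 + circle x 0 1 ^+ 2 = 1.
Proof. by rewrite !mxE /= cos2Dsin2. Qed.

(** The chord from [circle x] to [circle y] is [2 * sin (y - x)] times the unit vector of angle
    [x + y + pi / 2], so the chords to [circle y] and [circle z] differ in direction by [z - y]. *)
Lemma det3_circle x y z :
  det3 (circle x) (circle y) (circle z) =
  4 * (sin (y - x) * sin (z - y) * sin (z - x)).
Proof.
have C u v : cos (v *+ 2) - cos (u *+ 2) = - 2 * sin (u + v) * sin (v - u).
  rewrite !cos_mulr2n sinD sinB.
  have := sin2cos2 u; have := sin2cos2 v.
  move: (cos u) (sin u) (cos v) (sin v) => cu su cv sv Ev Eu.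
  ring: Ev Eu.
have S u v : sin (v *+ 2) - sin (u *+ 2) = 2 * cos (u + v) * sin (v - u).
  rewrite !sin_mulr2n cosD sinB.
  have := sin2cos2 u; have := sin2cos2 v.
  move: (cos u) (sin u) (cos v) (sin v) => cu su cv sv Ev Eu.
  ring: Ev Eu.
have -> : sin (z - y) = sin ((x + z) - (x + y)) by congr sin; ring.
rewrite /det3 !mxE /= !C !S [sin (_ - (x + y))]sinB.
ring.
Qed.

(** * Sine inequalities *)

Lemma sin_mul_ge h x y : 0 <= h -> h <= x -> h <= y -> x + y <= pi ->
  sin h * sin (x + y - h) <= sin x * sin y.
Proof.
move=> h0 hx hy xy; rewrite -subr_ge0.
have -> : sin x * sin y - sin h * sin (x + y - h) = sin (x - h) * sin (y - h).
  rewrite !sinB cosD sinD.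
  have := sin2cos2 h.
  move: (cos x) (sin x) (cos y) (sin y) (cos h) (sin h) => cx sx cy sy ch sh E.
  ring: E.
by rewrite mulr_ge0// sin_ge0_pi//; lra.
Qed.

(** The angles [x], [y], [pi - (x + y)] sum to [pi]. The first use of [sin_mul_ge] moves the first
    two to [h] and [x + y - h]; the second moves [x + y - h] and the third to [h] and
    [pi - h *+ 2]. *)
Lemma sin3_ge h x y : 0 <= h -> h <= x -> h <= y -> x + y <= pi - h ->
  sin h * sin h * sin (h *+ 2) <= sin x * sin y * sin (x + y).
Proof.
move=> h0 hx hy xy.
have sinpiB u : sin (pi - u) = sin u by rewrite sinB sinpi cospi; ring.
have s1 := @sin_mul_ge h x y h0 hx hy ltac:(lra).
have s2 := @sin_mul_ge h (x + y - h) (pi - (x + y)) h0 ltac:(lra) ltac:(lra) ltac:(lra).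
have e : x + y - h + (pi - (x + y)) - h = pi - h *+ 2 by rewrite mulr2n; ring.
rewrite e !sinpiB in s2.
have sh : 0 <= sin h by rewrite sin_ge0_pi//; lra.
have sxy : 0 <= sin (x + y) by rewrite sin_ge0_pi//; lra.
apply: le_trans (ler_wpM2r sxy s1).
by rewrite -!mulrA; apply: ler_wpM2l.
Qed.

(** * The regular polygon and its triangles *)

Variable n : nat.
Hypothesis n4 : (4 <= n)%N.

Let h : R := pi / n%:R.

(** Indices are not reduced modulo [n], so three consecutive vertices are always [i], [i.+1],
    [i.+2]; [vertexDn] wraps them around. *)
Definition vertex (i : nat) : 'rV[R]_2 := circle (i%:R * h).

Definition regular_polygon : {fset 'rV[R]_2} := [fset vertex (val i) | i : 'I_n].

(** The value of [det3] at three consecutive vertices, see [det3_ear]. *)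
Definition ear_det : R := 4 * (sin h * sin h * sin (h *+ 2)).

Let n0 : 0 < n%:R :> R. Proof. by rewrite ltr0n; lia. Qed.

Let nh : n%:R * h = pi. Proof. by rewrite /h mulrC divfK// gt_eqF. Qed.

Let h0 : 0 < h. Proof. by rewrite divr_gt0// pi_gt0. Qed.

Lemma sin_step_gt0 k : (0 < k < n)%N -> 0 < sin (k%:R * h).
Proof.
move=> /andP[k0 kn]; apply: sin_gt0_pi.
by rewrite -nh ltr_pM2r// ltr_nat kn mulr_gt0// ltr0n.
Qed.

Lemma ear_det_gt0 : 0 < ear_det.
Proof.
have s1 : 0 < sin h by have := @sin_step_gt0 1; rewrite mul1r; apply; lia.
have s2 : 0 < sin (h *+ 2) by have := @sin_step_gt0 2; rewrite mulr_natl; apply; lia.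
by rewrite /ear_det !mulr_gt0.
Qed.

Lemma vertexDn i : vertex (i + n) = vertex i.
Proof.
rewrite /vertex natrD mulrDl nh /circle.
apply/rowP => j; rewrite !mxE mulrnDl.
by rewrite (@cosD2pi R) (@sinD2pi R).
Qed.

Lemma vertex_lt_neq i j : (i < j < n)%N -> vertex i != vertex j.
Proof.
move=> ij; apply/negP => /eqP E.
have /eqP : sin ((j - i)%:R * h) ^+ 2 = 0.
  have : cos (((j - i)%:R * h) *+ 2) = 1.
    rewrite natrB; last lia.
    rewrite mulrBl mulrnBl cosB.
    have := congr1 (fun p : 'rV[R]_2 => p 0 0) E.
    have := congr1 (fun p : 'rV[R]_2 => p 0 1) E.
    by rewrite !mxE /= => -> ->; rewrite -!expr2 cos2Dsin2.
  by rewrite cos_mulr2n sin2cos2; lra.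
by rewrite sqrf_eq0 gt_eqF// sin_step_gt0//; lia.
Qed.

Lemma vertex_inj i j : (i < n)%N -> (j < n)%N -> vertex i = vertex j -> i = j.
Proof.
move=> i_n j_n E; have [ij|ji|//] := ltngtP i j.
  by have := @vertex_lt_neq i j; rewrite E eqxx ij j_n => /(_ isT).
by have := @vertex_lt_neq j i; rewrite E eqxx ji i_n => /(_ isT).
Qed.

(** The range up to [n.*2] covers the indices of all ears, which reach at most [n.+1]. *)
Lemma vertex_eq i j : (i < n.*2)%N -> (j < n.*2)%N -> vertex i = vertex j ->
  (i = j \/ i = j + n \/ j = i + n)%N.
Proof.
move=> i2 j2; have [i_n|n_i] := ltnP i n; have [j_n|n_j] := ltnP j n.
- by move=> /(vertex_inj i_n j_n) ->; left.
- rewrite -(subnK n_j) vertexDn => /vertex_inj; rewrite i_n => /(_ isT).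
  by move=> H; right; right; rewrite -H//; lia.
- rewrite -(subnK n_i) vertexDn => /vertex_inj; rewrite j_n => H.
  by right; left; rewrite H//; lia.
- rewrite -(subnK n_i) -(subnK n_j) !vertexDn => /vertex_inj H.
  by left; rewrite H//; lia.
Qed.

Lemma mem_regular_polygon i : (i < n.*2)%N -> vertex i \in regular_polygon.
Proof.
move=> i2; have [i_n|n_i] := ltnP i n.
  by apply/imfsetP; exists (Ordinal i_n).
rewrite -(subnK n_i) vertexDn; apply/imfsetP.
have i_n : (i - n < n)%N by lia.
by exists (Ordinal i_n).
Qed.

Lemma regular_polygonP p :
  p \in regular_polygon -> exists2 i, (i < n)%N & p = vertex i.
Proof. by move=> /imfsetP[i _ ->]; exists i. Qed.

Lemma card_regular_polygon : #|` regular_polygon| = n.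
Proof.
rewrite card_imfset /= ?size_enum_ord//.
by move=> i j /vertex_inj E; apply: val_inj; apply: E.
Qed.

Lemma det3_vertex_lt i j k : (i < j < k)%N -> (k < n)%N ->
  ear_det <= det3 (vertex i) (vertex j) (vertex k).
Proof.
move=> /andP[ij jk] kn; rewrite det3_circle /ear_det.
rewrite ler_pM2l// -!mulrBl.
have -> : (k%:R - i%:R) * h = (j%:R - i%:R) * h + (k%:R - j%:R) * h by ring.
have step a b : (a < b)%N -> h <= (b%:R - a%:R) * h.
  by move=> ab; rewrite -[leLHS]mul1r ler_pM2r// -natrB 1?ltnW// ler1n subn_gt0.
apply: sin3_ge; [exact: ltW|exact: step|exact: step|].
have -> : (j%:R - i%:R) * h + (k%:R - j%:R) * h = (k%:R - i%:R) * h by ring.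
(* Since [k - i <= n - 1], the third angle [pi - (k - i) h] is at least [h]. *)
have kn1 : k%:R - i%:R + 1 <= n%:R :> R.
  have : k.+1%:R <= n%:R :> R by rewrite ler_nat.
  by rewrite -natr1; have := ler0n R i; lra.
have := ler_wpM2r (ltW h0) kn1; rewrite nh; lra.
Qed.

Lemma det3_vertex_ge i j k : (i < n)%N -> (j < n)%N -> (k < n)%N ->
  i != j -> j != k -> i != k ->
  ear_det <= `|det3 (vertex i) (vertex j) (vertex k)|.
Proof.
move=> i_n j_n k_n ij jk ik.
have W a b c : (a < b < c)%N -> (c < n)%N ->
    ear_det <= `|det3 (vertex a) (vertex b) (vertex c)|.
  by move=> abc cn; apply: le_trans (ler_norm _); apply: det3_vertex_lt.
(* The six orders: three cyclic ones, then three that become cyclic after exchanging the last two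
   points. *)
have : [|| i < j < k, j < k < i | k < i < j]%N ||
       [|| i < k < j, k < j < i | j < i < k]%N.
  by lia.
case/orP => [|ikj]; last rewrite det3C normrN; [|move: ikj]; case/or3P => H.
all: by [apply: W | rewrite det3_rot; apply: W | rewrite -det3_rot; apply: W].
Qed.

Lemma det3_polygon_ge p q r :
  p \in regular_polygon -> q \in regular_polygon -> r \in regular_polygon ->
  p != q -> q != r -> p != r -> ear_det <= `|det3 p q r|.
Proof.
move=> /regular_polygonP[i i_n ->] /regular_polygonP[j j_n ->].
move=> /regular_polygonP[k k_n ->] pq qr pr.
by apply: det3_vertex_ge => //;
  [move: pq|move: qr|move: pr]; apply: contraNneq => ->.
Qed.

Lemma regular_polygon_convex_position : strictly_convex_position regular_polygon.
Proof.
split=> [p pS|p q r pS qS rS pq qr pr].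
  apply: unit_circle_extreme => //=.
    by move=> _ /regular_polygonP[i _ ->]; rewrite /disk /= circle_norm.
  by have [i _ ->] := regular_polygonP pS; rewrite circle_norm.
move=> /collinear_det3 E; have := det3_polygon_ge pS qS rS pq qr pr.
by rewrite E normr0 leNgt ear_det_gt0.
Qed.

(** * Ears of the regular polygon *)

Definition polygon_ear i := [fset vertex i; vertex i.+1; vertex i.+2].

Lemma det3_ear i : det3 (vertex i) (vertex i.+1) (vertex i.+2) = ear_det.
Proof.
rewrite det3_circle /ear_det -!natr1.
have -> : (i%:R + 1) * h - i%:R * h = h by ring.
have -> : (i%:R + 1 + 1) * h - (i%:R + 1) * h = h by ring.
by have -> : (i%:R + 1 + 1) * h - i%:R * h = h *+ 2 by ring.
Qed.

Lemma polygon_ear_neq i :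
  [/\ vertex i != vertex i.+1, vertex i.+1 != vertex i.+2 & vertex i != vertex i.+2].
Proof.
split; apply/negP => /eqP E.
- by have := ear_det_gt0; rewrite -(det3_ear i) E det3_rot det3_diag ltxx.
- by have := ear_det_gt0; rewrite -(det3_ear i) E det3_diagr ltxx.
- by have := ear_det_gt0; rewrite -(det3_ear i) E det3_diag ltxx.
Qed.

Lemma polygon_ear_min i : (i < n)%N ->
  polygon_ear i \in min_area_triangles regular_polygon.
Proof.
move=> i_n; have [n1 n2 n3] := polygon_ear_neq i.
apply/min_area_trianglesP; split.
  rewrite !inE fpowersetE cardfs3// eqxx andbT.
  by apply/fsubsetP => u; rewrite !inE => /orP[/orP[]|] /eqP->;
    apply: mem_regular_polygon; lia.
move=> T; rewrite !inE fpowersetE => /andP[TS /eqP/fset3P[p [q [r [TE pq qr pr]]]]].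
rewrite TE !triangle_areaE// !area3_det3 ler_pM2r// det3_ear.
rewrite gtr0_norm ?ear_det_gt0//.
by apply: det3_polygon_ge => //; apply: (fsubsetP TS); rewrite TE !inE eqxx ?orbT.
Qed.

Lemma polygon_ear_inj i j : (i < n)%N -> (j < n)%N ->
  polygon_ear i = polygon_ear j -> i = j.
Proof.
move=> i_n j_n E.
have mem k : (k < n.*2)%N -> vertex k \in polygon_ear i ->
    exists2 l, (j <= l <= j.+2)%N & (k = l \/ k = l + n \/ l = k + n)%N.
  move=> k2; rewrite E !inE => /orP[/orP[]|] /eqP/vertex_eq H.
  - by exists j; [lia|apply: H; lia].
  - by exists j.+1; [lia|apply: H; lia].
  - by exists j.+2; [lia|apply: H; lia].
have [] := mem i; [lia|by rewrite !inE eqxx|move=> a ja Ha].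
have [] := mem i.+1; [lia|by rewrite !inE eqxx orbT|move=> b jb Hb].
have [] := mem i.+2; [lia|by rewrite !inE eqxx !orbT|move=> c jc Hc].
(* Modulo [n], the residues of [i], [i + 1], [i + 2] all lie in the window from [j] to [j + 2]. For
   [n >= 4] this forces [i = j], whereas for [n = 3] all windows coincide. *)
lia.
Qed.

Lemma card_min_area_regular_polygon :
  (n <= #|` min_area_triangles regular_polygon|)%N.
Proof.
have <- : #|` [fset polygon_ear (val i) | i : 'I_n]| = n.
  rewrite card_imfset /= ?size_enum_ord//.
  by move=> i j /polygon_ear_inj E; apply: val_inj; apply: E.
apply/fsubset_leq_card/fsubsetP => _ /imfsetP[i _ ->].
by apply: polygon_ear_min; apply: ltn_ord.
Qed.

End RegularPolygon.

Theorem theorem5 (R : realType) :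
  (exists C : R, 0 < C /\
     forall (n : nat) (S : {fset 'rV[R]_2}),
       (3 <= n)%N -> #|` S| = n -> strictly_convex_position S ->
       (#|` min_area_triangles S|)%:R <= C * n%:R) /\
  (forall n : nat, (4 <= n)%N ->
     exists S : {fset 'rV[R]_2},
       [/\ #|` S| = n, strictly_convex_position S &
           (n <= #|` min_area_triangles S|)%N]).
Proof.
split.
  exists 1; split=> // n S _ <- scp.
  by rewrite mul1r ler_nat card_min_area_triangles_le.
move=> n n4; exists (regular_polygon R n); split.
- exact: card_regular_polygon.
- exact: regular_polygon_convex_position.
- exact: card_min_area_regular_polygon.
Qed.
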